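(* Let $b$ and $n$ be positive integers and let $T$ be a non-empty subset of $[n]=\{1,\dots,n\}$ such that $\max(T)+3b\le 2n<4b$. Then the independence number of the graph $\Gamma(n,T\cup\{b\})$ equals $\binom{n-1}{b}\cdot |V\Gamma(b,T)|$, where $|V\Gamma(b,T)|$ denotes the number of flags of $[b]$ of type $T$.
   Context: For an integer $n\ge 0$, $[n]:=\{i\in\mathbb Z: 1\le i\le n\}$. Let $S$ be a non-empty finite set. Two subsets $X,Y$ of $S$ are in general position (with respect to $S$) if $X\cup Y=S$ or $X\cap Y=\emptyset$. A flag of $S$ is a set $f$ of non-empty proper subsets of $S$ such that $X\subseteq Y$ or $Y\subseteq X$ for all $X,Y\in f$; its type is $\{|X|: X\in f\}$. Two flags $f,f'$ of $S$ are in general position if $X$ and $X'$ are in general position for all $X\in f$, $X'\in f'$. For $T\subseteq[|S|-1]$, $\Gamma(S,T)$ is the graph whose vertices are the flags of $S$ of type $T$, two vertices being adjacent iff the flags are in general position; $\Gamma(n,T):=\Gamma([n],T)$, and $V\Gamma$ denotes the vertex set of a graph $\Gamma$. The independence number of a graph is the maximum size of a set of pairwise non-adjacent vertices. *)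

(* Defs.v *)
From mathcomp Require Import all_boot.
From mathcomp Require Import finmap.

Set Implicit Arguments.
Unset Strict Implicit.
Unset Printing Implicit Defensive.

Record sgraph := SGraph {
  vertex :> finType;
  adj : rel vertex;
  adj_sym : symmetric adj;
  adj_irr : irreflexive adj
}.

Definition independent (G : sgraph) (A : {set G}) : bool :=
  [forall x in A, forall y in A, ~~ adj x y].

Definition independence_number (G : sgraph) : nat :=
  \max_(A : {set G} | independent A) #|A|.

Section Flags.
Variable S : finType.

Definition general_position (X Y : {set S}) : bool :=
  (X :|: Y == [set: S]) || (X :&: Y == set0).

Definition is_flag (f : {set {set S}}) : bool :=
  [forall X in f, (X != set0) && (X != [set: S])] &&
  [forall X in f, forall Y in f, (X \subset Y) || (Y \subset X)].

Definition flag_type (f : {set {set S}}) : {fset nat} :=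
  [fset #|(X : {set S})| | X in f]%fset.

Definition flags_general_position (f f' : {set {set S}}) : bool :=
  [forall X in f, forall X' in f', general_position X X'].

Variable T : {fset nat}.

Local Notation flag_of_type :=
  {f : {set {set S}} | is_flag f && (flag_type f == T)}.

(* A non-empty flag is never in general position with itself, because its
   members are non-empty and proper; so [f != f'] is redundant unless [T] is
   empty, in which case it excludes a loop at the empty flag. *)
Definition flag_adj (f f' : flag_of_type) : bool :=
  (f != f') && flags_general_position (val f) (val f').

Lemma general_positionC : symmetric general_position.
Proof. by move=> X Y; rewrite /general_position setUC setIC. Qed.

Lemma flags_general_positionC : symmetric flags_general_position.
Proof.
move=> f f'; rewrite /flags_general_position.
apply/idP/idP => /forall_inP fgp; apply/forall_inP => X fX;
apply/forall_inP => Y fY; rewrite general_positionC;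
by have /forall_inP -> := fgp _ fY.
Qed.

Lemma flag_adj_sym : symmetric flag_adj.
Proof.
by move=> f f'; rewrite /flag_adj eq_sym flags_general_positionC.
Qed.

Lemma flag_adj_irr : irreflexive flag_adj.
Proof. by move=> f; rewrite /flag_adj eqxx. Qed.

(* Intended for [T] contained in {1, ..., #|S| - 1}; for any other [T] there
   is no flag of type [T] and the graph has no vertex. *)
Definition Gamma_on : sgraph := SGraph flag_adj_sym flag_adj_irr.

End Flags.

(* The [n]-element ground set {1, ..., n} is represented by ['I_n]. *)
Definition Gamma (n : nat) (T : {fset nat}) : sgraph := Gamma_on 'I_n T.

(* Main.v *)
(* Katona's cycle argument.  Write [c = n - b]; the hypotheses give
   [max T + b <= 2c] and [c < b], so every member of a flag other than its
   [b]-set is smaller than [b] and is contained in the [b]-set.  Arrange the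
   ground set in a cycle and consider the [n] rotations of a flag whose [b]-set
   is an arc and whose other members lie in the central [2c - b] points of this
   arc.  Two rotations whose [b]-sets cover the cycle are then in general
   position, so an independent set contains at most [c] of the [n] rotations, as
   for the intersecting families of arcs in Katona's proof of Erdos-Ko-Rado.
   Averaging over all arrangements bounds an independent set by [c / n] times
   the number of flags.  Equality holds for the flags whose [b]-set misses a
   given point, since two such [b]-sets neither cover nor are disjoint. *)
Require Import Defs.
From mathcomp Require Import all_boot.
From mathcomp Require Import finmap.
From mathcomp Require Import fingroup perm.
From mathcomp Require Import zify.

Set Implicit Arguments.
Unset Strict Implicit.
Unset Printing Implicit Defensive.

(** * Flags of a given type *)

Section FlagBasics.
Variable S : finType.
Implicit Types (f : {set {set S}}) (X Y : {set S}) (T : {fset nat}).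

(** Plain sets of sets in place of the vertices of [Gamma_on]: flags can then be permuted and
    transported without carrying proofs. *)
Definition flags T : {set {set {set S}}} :=
  [set f | is_flag f && (flag_type f == T)].

Lemma card_Gamma_on T : #|Gamma_on S T| = #|flags T|.
Proof. by rewrite /= card_sig cardsE. Qed.

Lemma flagsP f T :
  reflect [/\ forall X, X \in f -> 0 < #|X| < #|S|,
              forall X Y, X \in f -> Y \in f -> (X \subset Y) || (Y \subset X),
              forall X, X \in f -> #|X| \in T &
              forall k, k \in T -> exists2 X, X \in f & #|X| = k]
          (f \in flags T).
Proof.
have propE X : (X != set0) && (X != [set: S]) = (0 < #|X| < #|S|).
  by rewrite card_gt0 [X == setT]eqEcard subsetT cardsT -ltnNge.
rewrite inE /is_flag -andbA; apply: (iffP and3P).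
  case=> /forall_inP proper /forall_inP chain /eqP <-; split.
  - by move=> X /proper; rewrite propE.
  - by move=> X Y fX fY; have /forall_inP-> := chain _ fX.
  - by move=> X fX; apply/imfsetP; exists X.
  - by move=> k /imfsetP[X /= fX ->]; exists X.
case=> proper chain type1 type2; split.
- by apply/forall_inP => X fX; rewrite propE proper.
- by apply/forall_inP => X fX; apply/forall_inP => Y fY; apply: chain.
apply/eqP/fsetP => k; apply/imfsetP/idP => [[X /= fX ->]|/type2[X fX <-]].
  exact: type1.
by exists X.
Qed.

Lemma flags_card_inj f T X Y :
  f \in flags T -> X \in f -> Y \in f -> #|X| = #|Y| -> X = Y.
Proof.
case/flagsP=> _ chain _ _ fX fY eqXY.
by case/orP: (chain _ _ fX fY) => sub; apply/eqP;
  [|rewrite eq_sym]; rewrite eqEcard sub eqXY /=.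
Qed.

End FlagBasics.

Arguments flags : clear implicits.

(** * Flags made of arcs *)

Lemma card_arc n a k :
  a + k <= n -> #|[set x : 'I_n | a <= x < a + k]| = k.
Proof.
move=> le_akn; rewrite -sum1dep_card.
rewrite (eq_bigl (fun i : 'I_n => (i < a + k) && (a <= i))); last first.
  by move=> i; rewrite andbC.
rewrite -(big_geq_mkord a n (fun i => i < a + k) (fun=> 1)).
by rewrite -(big_nat_widen _ _ _ predT) // sum_nat_const_nat muln1 addKn.
Qed.

Section ArcFlags.
Variables (n : nat) (T : {fset nat}) (a : nat -> nat).

Definition arc_flag : {set {set 'I_n}} :=
  [set [set x : 'I_n | a k <= x < a k + k] | k : 'I_n & (k : nat) \in T].

Lemma arc_flagP :
  (forall k, k \in T -> 0 < k < n) ->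
  (forall k, k \in T -> a k + k <= n) ->
  (forall k l, k \in T -> l \in T -> k <= l ->
     a l <= a k /\ a k + k <= a l + l) ->
  arc_flag \in flags 'I_n T.
Proof.
move=> T_proper arc_le nested; apply/flagsP; split.
- move=> _ /imsetP[k /[!inE] Tk ->]; rewrite card_arc ?arc_le // card_ord.
  exact: T_proper.
- move=> _ _ /imsetP[k /[!inE] Tk ->] /imsetP[l /[!inE] Tl ->].
  case/orP: (leq_total k l) => le_kl; apply/orP; [left | right];
  apply/subsetP => x; rewrite !inE.
    have [] := nested _ _ Tk Tl le_kl; lia.
  have [] := nested _ _ Tl Tk le_kl; lia.
- by move=> _ /imsetP[k /[!inE] Tk ->]; rewrite card_arc ?arc_le.
- move=> k Tk; have /andP[_ lt_kn] := T_proper _ Tk.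
  exists [set x : 'I_n | a k <= x < a k + k]; last by rewrite card_arc ?arc_le.
  by apply/imsetP; exists (Ordinal lt_kn); rewrite ?inE.
Qed.

End ArcFlags.

(** * Permutations acting on flags, averaging, and Katona's cycle lemma *)

Section PermAction.
Variable S : finType.
Implicit Types (f : {set {set S}}) (s t : {perm S}).

(** Preimages are taken because [(s * t) x = t (s x)]: products then act without reversal of the
    order. *)
Definition perm_flag s f : {set {set S}} := [set s @^-1: (X : {set S}) | X in f].

Lemma perm_flagM s t f : perm_flag (s * t)%g f = perm_flag s (perm_flag t f).
Proof.
rewrite /perm_flag -imset_comp; apply: eq_imset => X /=.
by apply/setP => x; rewrite !inE permM.
Qed.

Lemma perm_flag1 f : perm_flag 1%g f = f.
Proof.
rewrite -[RHS]imset_id; apply: eq_imset => X.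
by apply/setP => x; rewrite !inE perm1.
Qed.

Lemma card_perm_preim s (X : {set S}) : #|s @^-1: X| = #|X|.
Proof. exact/card_preimset/perm_inj. Qed.

Lemma perm_flag_flags s f T : f \in flags S T -> perm_flag s f \in flags S T.
Proof.
case/flagsP=> proper chain type1 type2; apply/flagsP; split.
- by move=> _ /imsetP[X fX ->]; rewrite card_perm_preim proper.
- move=> _ _ /imsetP[X fX ->] /imsetP[Y fY ->].
  by case/orP: (chain _ _ fX fY) => sub; rewrite (preimsetS _ sub) ?orbT.
- by move=> _ /imsetP[X fX ->]; rewrite card_perm_preim type1.
- move=> k /type2[X fX <-]; exists (s @^-1: X); last exact: card_perm_preim.
  exact: imset_f.
Qed.

End PermAction.

(** Once [X] fails at an entry it fails at all later ones, so it holds exactly on an initial block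
    of [s]. *)
Lemma sorted_upclosed_index (S : eqType) (e : rel S) (X : pred S) (s : seq S) :
  transitive e -> (forall x y, e x y -> X y -> X x) ->
  uniq s -> sorted e s ->
  forall x, x \in s -> X x = (index x s < count X s).
Proof.
move=> e_tr Xup; elim: s => //= y s IHs /andP[ys us] e_ys x.
rewrite inE; have [Xy|nXy] := boolP (X y).
  case: eqVneq => [->|_] /= xs; first by rewrite Xy.
  by rewrite IHs // (path_sorted e_ys).
have allN z : z \in s -> ~~ X z.
  move=> sz; apply: contra nXy; apply: Xup.
  by move/allP: (order_path_min e_tr e_ys); apply.
have /eqP-> : count X s == 0.
  by rewrite -leqn0 leqNgt -has_count -all_predC; apply/allP.
rewrite ltn0; case: eqVneq => [->|_] /= xs; first exact: negbTE.
exact: (negbTE (allN _ xs)).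
Qed.

(* Listing the points by decreasing number of members containing them makes
   every member of the flag an initial segment. *)
Lemma flag_perm_arc n T (f : {set {set 'I_n}}) :
  f \in flags 'I_n T ->
  exists s : {perm 'I_n}, f = perm_flag s (arc_flag n T (fun=> 0)).
Proof.
case/flagsP=> proper chain type1 type2.
pose h x := #|[set X in f | x \in (X : {set 'I_n})]|.
pose e x y := h y <= h x.
pose l := sort e (enum 'I_n).
have l_uniq : uniq l by rewrite sort_uniq enum_uniq.
have l_mem x : x \in l by rewrite mem_sort mem_enum.
have l_size : size l = n by rewrite size_sort size_enum_ord.
have idx_lt x : index x l < n by rewrite -[X in _ < X]l_size index_mem.
have idx_inj : injective (fun x => Ordinal (idx_lt x)).
  move=> x y /(congr1 val) /= eq_xy.
  by rewrite -(nth_index x (l_mem x)) eq_xy nth_index.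
have segment X x : X \in f -> (x \in X) = (index x l < #|X|).
  move=> fX; have -> : #|X| = count (mem X) l.
    by rewrite (seq.permP (permEl (perm_sort e _))) cardE enumT size_filter.
  apply: (@sorted_upclosed_index _ e) => //.
  - by move=> y u v /[swap]; apply: leq_trans.
  (* If [v] is in [X] and [u] is not, a member containing [u] is not inside [X], so it contains [X]
     and hence [v]. As [X] itself contains only [v], this gives [h u < h v]. *)
  - move=> u v /= e_uv Xv; apply: contraLR e_uv => nXu; have {}nXu : u \notin X by [].
    rewrite -ltnNge; apply: proper_card; apply/properP; split.
      apply/subsetP => Y /[!inE] /andP[fY Yu]; rewrite fY /=.
      case/orP: (chain _ _ fX fY) => /subsetP sub; first exact: sub.
      by rewrite (sub _ Yu) in nXu.
    by exists X; rewrite !inE fX // (negbTE nXu).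
  - by apply: sort_sorted => u v; apply: leq_total.
have mem_segment X : X \in f ->
    X = perm idx_inj @^-1: [set x : 'I_n | 0 <= x < 0 + #|X|].
  by move=> fX; apply/setP => x; rewrite !inE permE /= -segment.
exists (perm idx_inj); apply/setP => X; apply/idP/imsetP.
  move=> fX; have := mem_segment _ fX; have := type1 _ fX.
  have /andP[_] := proper _ fX; rewrite card_ord.
  move: #|X| => k lt_kn Tk ->.
  exists [set x : 'I_n | 0 <= x < 0 + k] => //.
  by apply/imsetP; exists (Ordinal lt_kn); rewrite ?inE.
case=> _ /imsetP[k /[!inE] /type2[Y fY <-] ->] ->.
by rewrite -mem_segment.
Qed.

Lemma perm_flag_transitive n T (f g : {set {set 'I_n}}) :
  f \in flags 'I_n T -> g \in flags 'I_n T ->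
  exists s : {perm 'I_n}, g = perm_flag s f.
Proof.
case/flag_perm_arc=> s -> /flag_perm_arc[t ->]; exists (t * s^-1)%g.
by rewrite -perm_flagM mulgKV.
Qed.

Lemma card_setE (S : finType) (P : pred S) : #|[set x | P x]| = \sum_x P x.
Proof. by rewrite -sum1dep_card big_mkcond; apply: eq_bigr => x _; case: P. Qed.

(** Orbit and stabiliser: by transitivity, the permutations taking [f] to a given [g] in [A] form a
    left coset of the stabiliser of [f]. *)
Lemma card_perm_flag_in n T (f : {set {set 'I_n}}) (A : {set {set {set 'I_n}}}) :
  f \in flags 'I_n T -> A \subset flags 'I_n T ->
  #|[set s | perm_flag s f \in A]| = #|A| * #|[set s | perm_flag s f == f]|.
Proof.
move=> flag_f /subsetP sA; rewrite -sum1dep_card.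
rewrite (partition_big (fun s => perm_flag s f) (mem A)) //= -sum_nat_const.
apply: eq_bigr => g Ag.
have [r def_g] := perm_flag_transitive flag_f (sA _ Ag).
rewrite sum1dep_card -[RHS](card_imset _ (mulgI r)); apply/eq_card => s.
rewrite !inE; apply/andP/imsetP => [[_ /eqP fg]|[t /[!inE] /eqP tf ->]].
  exists (r^-1 * s)%g; rewrite ?mulKVg // inE perm_flagM fg def_g.
  by rewrite -perm_flagM mulVg perm_flag1.
by rewrite perm_flagM tf -def_g Ag.
Qed.

(* The permutation group being transitive on flags of type [T], a family [A]
   occupies no more of all flags than of some translate of the [m] flags
   [perm_flag (t i) f]. *)
Lemma perm_flag_average n T m c (t : 'I_m -> {perm 'I_n})
    (f : {set {set 'I_n}}) (A : {set {set {set 'I_n}}}) :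
  f \in flags 'I_n T -> A \subset flags 'I_n T ->
  (forall s, #|[set i | perm_flag (s * t i)%g f \in A]| <= c) ->
  m * #|A| <= c * #|flags 'I_n T|.
Proof.
move=> flag_f sA cA; set w := #|[set s | perm_flag s f == f]|.
have w_gt0 : 0 < w.
  by apply/card_gt0P; exists 1%g; rewrite inE perm_flag1.
have all_s : #|flags 'I_n T| * w = #|{perm 'I_n}|.
  rewrite -(card_perm_flag_in flag_f (subxx _)) -cardsT; apply: eq_card => s.
  by rewrite in_setT inE perm_flag_flags.
rewrite -(leq_pmul2r w_gt0) -!mulnA all_s.
rewrite -(card_perm_flag_in flag_f sA) mulnC [c * _]mulnC.
(* Double counting of the pairs [(s, i)]: for fixed [i], right multiplication by [t i] permutes the
   [s]. *)
have -> : #|[set s | perm_flag s f \in A]| * m =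
    \sum_(i < m) \sum_s (perm_flag (s * t i)%g f \in A).
  rewrite mulnC -[X in X * _]card_ord -sum_nat_const; apply: eq_bigr => i _.
  by rewrite card_setE (reindex_inj (mulIg (t i))).
rewrite exchange_big -sum_nat_const; apply: leq_sum => s _.
by rewrite -card_setE.
Qed.

(* Translating so that the least element of [A] is [0], an element [d < c]
   and the element [d + (n - c)] exclude each other. *)
Lemma katona_cycle n c (A : {set 'I_n}) :
  0 < c -> 2 * c <= n ->
  (forall i j : 'I_n, i \in A -> j \in A -> i < j ->
     ~~ (c <= j - i <= n - c)) ->
  #|A| <= c.
Proof.
move=> c_gt0 le_cn sep.
have [->|[i0 Ai0]] := set_0Vmem A; first by rewrite cards0.
case: (arg_minnP (fun i : 'I_n => i : nat) Ai0) => m Am min_m {i0 Ai0}.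
(* Since [m] is in [A], the distance [i - m] is below [c] or above [n - c]; lowering the latter by
   [n - c] brings all of them below [c]. *)
pose v (i : 'I_n) := if i - m < c then i - m else i - m - (n - c).
have v_lt i : i \in A -> v i < c.
  by move=> Ai; rewrite /v; have := ltn_ord i; case: ifP; lia.
(* The reduction modulo [c] only makes [w] total; on [A] it changes nothing. *)
pose w i := Ordinal (ltn_pmod (v i) c_gt0).
suff w_inj : {in A &, injective w}.
  by rewrite -(card_in_imset w_inj) -[X in _ <= X]card_ord max_card.
move=> i j Ai Aj /(congr1 val) /=; rewrite !modn_small ?v_lt // /v => eq_v.
apply: val_inj => /=.
have := min_m _ Ai; have := min_m _ Aj.
have := sep _ _ Am Ai; have := sep _ _ Am Aj.
have := sep _ _ Ai Aj; have := sep _ _ Aj Ai.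
have := ltn_ord i; have := ltn_ord j.
by move: eq_v; case: ifP; case: ifP; lia.
Qed.

(** * Counting flags through prescribed sets *)

Section FlagsThrough.
Variables (S : finType) (T : {fset nat}).

(** The other members are smaller than [B], hence inside [B] by the chain condition; removing [B]
    leaves a flag of type [T] of [B], which [enum_val] identifies with ['I_#|B|]. *)
Lemma card_flags_through (B : {set S}) :
  0 < #|B| < #|S| -> (forall k, k \in T -> k < #|B|) ->
  #|[set f in flags S (T `|` [fset #|B|])%fset | B \in f]| =
    #|flags 'I_#|B| T|.
Proof.
move=> B_proper T_lt; pose e : 'I_#|B| -> S := enum_val.
have e_inj : injective e by exact: enum_val_inj.
have eB i : e i \in B by exact: enum_valP.
have e_onto (Y : {set S}) : Y \subset B -> e @: (e @^-1: Y) = Y.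
  move=> /subsetP sYB; apply/setP => y; apply/imsetP/idP => [[x]|Yy].
    by rewrite inE => ? ->.
  by exists (enum_rank_in (sYB _ Yy) y);
    rewrite ?inE /e enum_rankK_in // sYB.
pose F (g : {set {set 'I_#|B|}}) := B |: [set e @: (X : {set _}) | X in g].
(* The size condition rules out the full set, whose image [B] is in [F g] without coming from
   [g]. *)
have memF g X : g \in flags 'I_#|B| T ->
    (X \in g) = (#|X| < #|B|) && (e @: X \in F g).
  case/flagsP=> proper _ _ _; apply/idP/andP => [gX|[lt_XB]].
    have := proper _ gX; rewrite card_ord => /andP[_ ->].
    by split=> //; apply/setU1P; right; apply: imset_f.
  case/setU1P=> [eXB|/imsetP[Y gY /imset_inj-> //]].
  by move: lt_XB; rewrite -(card_imset _ e_inj) eXB ltnn.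
rewrite -(card_in_imset (f := F)); last first.
  by move=> g h flag_g flag_h eqF; apply/setP => X; rewrite !memF // eqF.
apply: eq_card => f; rewrite inE; apply/andP/imsetP; last first.
  case=> g flag_g ->; split; last exact: setU11.
  case/flagsP: flag_g => proper chain type1 type2; apply/flagsP; split.
  - move=> _ /setU1P[->//|/imsetP[X gX ->]].
    rewrite card_imset //; have := proper _ gX; rewrite card_ord.
    by case/andP=> -> ltXB; case/andP: B_proper => _; apply: ltn_trans.
  - have sub X : e @: X \subset B.
      by apply/subsetP => _ /imsetP[x _ ->].
    move=> _ _ /setU1P[->|/imsetP[X gX ->]] /setU1P[->|/imsetP[Y gY ->]];
      rewrite ?subxx ?sub ?orbT //.
    by case/orP: (chain _ _ gX gY) => sXY; rewrite (imsetS _ sXY) ?orbT.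
  - move=> _ /setU1P[->|/imsetP[X gX ->]]; rewrite in_fsetU in_fset1.
      by rewrite eqxx orbT.
    by rewrite card_imset // type1.
  - move=> k; rewrite in_fsetU in_fset1 => /orP[/type2[X gX <-]|/eqP->].
      exists (e @: X); last exact: card_imset.
      by apply/setU1P; right; apply: imset_f.
    by exists B => //; apply: setU11.
case=> flag_f fB; have /flagsP[proper chain type1 type2] := flag_f.
have lt_B Y : Y \in f -> Y != B -> #|Y| < #|B|.
  move=> fY neqYB; have := type1 _ fY; rewrite in_fsetU in_fset1.
  case/orP=> [/T_lt //|/eqP eqYB].
  by rewrite (flags_card_inj flag_f fY fB eqYB) eqxx in neqYB.
have sub_B Y : Y \in f -> Y \subset B.
  move=> fY; have [->//|neqYB] := eqVneq Y B.
  case/orP: (chain _ _ fY fB) => // /subset_leq_card.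
  by rewrite leqNgt lt_B.
exists [set X : {set 'I_#|B|} | (e @: X \in f) && (#|X| < #|B|)]; last first.
  apply/setP => Y; apply/idP/setU1P.
    move=> fY; have [->|neqYB] := eqVneq Y B; first by left.
    right; apply/imsetP; exists (e @^-1: Y); rewrite ?e_onto ?sub_B //.
    by rewrite inE -(card_imset _ e_inj) e_onto ?sub_B // fY lt_B.
  by case=> [->//|/imsetP[X /[!inE] /andP[fX _] ->]].
apply/flagsP; split.
- move=> X /[!inE] /andP[fX ltXB]; rewrite card_ord ltXB.
  by have := proper _ fX; rewrite card_imset // => /andP[->].
- move=> X Y /[!inE] /andP[fX _] /andP[fY _].
  case/orP: (chain _ _ fX fY) => /subsetP sub; apply/orP; [left | right];
    by apply/subsetP => x /(imset_f e)/sub; rewrite mem_imset.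
- move=> X /[!inE] /andP[fX ltXB]; have := type1 _ fX.
  by rewrite card_imset // in_fsetU in_fset1 (ltn_eqF ltXB) orbF.
- move=> k Tk; have ltkB := T_lt _ Tk.
  have [|Y fY cardY] := type2 k; first by rewrite in_fsetU Tk.
  exists (e @^-1: Y); last by rewrite -(card_imset _ e_inj) e_onto ?sub_B.
  by rewrite inE -(card_imset _ e_inj) e_onto ?sub_B // fY cardY.
Qed.

(** A flag has at most one member of size [b], so the families of flags through the various [B] in
    [BB] are disjoint. *)
Lemma card_flags_over (b : nat) (BB : {set {set S}}) :
  0 < b < #|S| -> (forall k, k \in T -> k < b) ->
  (forall B, B \in BB -> #|B| = b) ->
  #|[set f in flags S (T `|` [fset b])%fset | [exists B in BB, B \in f]]| =
    #|BB| * #|flags 'I_b T|.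
Proof.
move=> b_proper T_lt cardBB; set T' := (T `|` _)%fset.
rewrite -sum_nat_const.
transitivity (\sum_(B in BB) #|[set f in flags S T' | B \in f]|); last first.
  apply: eq_bigr => B BBB; rewrite /T' -(cardBB _ BBB).
  by apply: card_flags_through; rewrite (cardBB _ BBB).
under eq_bigr do rewrite card_setE.
rewrite exchange_big /= card_setE; apply: eq_bigr => f _.
have [flag_f|_] := boolP (f \in _) => /=; last by rewrite big1.
case: exists_inP => [[B BBB fB]|noB].
  rewrite (bigD1 B) //= fB big1 // => C /andP[BBC neqCB].
  apply/eqP; rewrite eqb0; apply: contra neqCB => fC; apply/eqP.
  by apply: flags_card_inj flag_f fC fB _; rewrite !cardBB.
rewrite big1 // => B BBB; apply/eqP; rewrite eqb0; apply/negP => fB.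
by apply: noB; exists B.
Qed.

End FlagsThrough.

Lemma flag_not_general_self (S : finType) T k (f : {set {set S}}) :
  f \in flags S T -> k \in T -> ~~ flags_general_position f f.
Proof.
case/flagsP=> proper _ _ type2 /type2[X fX _]; apply/negP => /forall_inP gp.
have /forall_inP/(_ X fX) := gp _ fX.
have /andP[X_gt0 X_lt] := proper _ fX.
rewrite /general_position setUid setIid -cards_eq0.
rewrite (gtn_eqF X_gt0) orbF => /eqP XS.
by rewrite XS cardsT ltnn in X_lt.
Qed.

Lemma modn_addE n x y : x < n -> y < n ->
  (x + y) %% n = if x + y < n then x + y else x + y - n.
Proof.
move=> lt_xn lt_yn; case: ltnP => [/modn_small //|le_n].
by rewrite -[in LHS](subnK le_n) modnDr modn_small //; lia.
Qed.

(** * The rotations of a flag of arcs *)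

Section CycleOfFlags.
Variables (n b : nat) (T : {fset nat}).
Hypotheses (n_gt0 : 0 < n) (n_lt : n < 2 * b) (b_lt : b < n).
Hypothesis T_gt0 : forall k, k \in T -> 0 < k.
Hypothesis T_le : forall k, k \in T -> k + 3 * b <= 2 * n.

Local Notation T' := (T `|` [fset b])%fset.

Definition shift_ord (i : nat) (x : 'I_n) : 'I_n :=
  Ordinal (ltn_pmod (x + i) n_gt0).

Lemma shift_ord_inj i : injective (shift_ord i).
Proof.
move=> x y /(congr1 val) /= /eqP; rewrite eqn_modDr.
by rewrite !modn_small // => /eqP/val_inj.
Qed.

Definition shift_perm (i : 'I_n) : {perm 'I_n} := perm (@shift_ord_inj i).

(* The arc [2b - n, n - b) that holds the members of size in [T] meets no
   translate of [0, b) by a distance in [n - b, b]. *)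
Definition base_flag : {set {set 'I_n}} :=
  arc_flag n T' (fun k => if k == b then 0 else 2 * b - n).

Lemma base_flagP : base_flag \in flags 'I_n T'.
Proof.
have T'_cases k : k \in T' -> k = b \/ 0 < k /\ k + 3 * b <= 2 * n.
  rewrite in_fsetU in_fset1 => /orP[Tk|/eqP->]; last by left.
  by right; split; [exact: T_gt0|exact: T_le].
apply: arc_flagP => [k|k|k l].
- by case/T'_cases; lia.
- by case/T'_cases; case: eqP; lia.
- by case/T'_cases=> [->|?]; case/T'_cases=> [->|?]; do 2?case: eqP; lia.
Qed.

Lemma base_flag_member (X : {set 'I_n}) : X \in base_flag ->
  (forall x : 'I_n, (x \in X) = (x < b)) \/
  (forall x : 'I_n, x \in X -> 2 * b - n <= x < n - b).
Proof.
case/imsetP=> k /[!inE] T'k ->; have [->|neqkb] := eqVneq (k : nat) b.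
  by left=> x; rewrite inE.
have le_k : k + 3 * b <= 2 * n.
  move: T'k; rewrite in_fsetU in_fset1 => /orP[/T_le //|/eqP eq_kb].
  by rewrite eq_kb eqxx in neqkb.
by right=> x; rewrite inE; lia.
Qed.

(** Modulo [n], a translation by a distance in [[n - b, b]] sends [[b, n)] into [[0, b)], so the two
    [b]-sets cover. It sends the window [[2b - n, n - b)] into [[b, n)] and [[0, b)] off the window.
    As the window lies in [[0, b)], all other pairs are disjoint. *)
Lemma base_flag_shift_general (s : {perm 'I_n}) (i j : 'I_n) :
  i < j -> n - b <= j - i <= b ->
  flags_general_position (perm_flag (s * shift_perm i)%g base_flag)
                         (perm_flag (s * shift_perm j)%g base_flag).
Proof.
move=> lt_ij dist_ij; apply/forall_inP => _ /imsetP[X fX ->].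
apply/forall_inP => _ /imsetP[Y fY ->]; apply/orP.
(* Both memberships are read off in the coordinates of [base_flag]; the second alternative for [v]
   is the case of wrapping around. *)
have shifts x : exists u v : 'I_n,
    [/\ (s * shift_perm i)%g x = u, (s * shift_perm j)%g x = v
      & (v : nat) = u + (j - i) \/ v + n = u + (j - i)].
  exists (shift_ord i (s x)), (shift_ord j (s x)).
  rewrite !permM !permE; split=> //=.
  have := ltn_ord (s x); have := ltn_ord j; have := ltn_ord i.
  by rewrite !modn_addE //; case: ifP; case: ifP; lia.
have [X_B|X_win] := base_flag_member fX;
  have [Y_B|Y_win] := base_flag_member fY.
- left; apply/eqP/setP => x; have [u [v [eq_u eq_v def_v]]] := shifts x.
  rewrite !inE eq_u eq_v X_B Y_B.
  by have := ltn_ord u; have := ltn_ord v; lia.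
- right; apply/eqP/setP => x; have [u [v [eq_u eq_v def_v]]] := shifts x.
  rewrite !inE eq_u eq_v X_B; apply/andP => -[lt_ub /Y_win].
  by have := ltn_ord u; have := ltn_ord v; lia.
- right; apply/eqP/setP => x; have [u [v [eq_u eq_v def_v]]] := shifts x.
  rewrite !inE eq_u eq_v Y_B; apply/andP => -[/X_win u_win lt_vb].
  by have := ltn_ord u; have := ltn_ord v; lia.
- right; apply/eqP/setP => x; have [u [v [eq_u eq_v def_v]]] := shifts x.
  rewrite !inE eq_u eq_v; apply/andP => -[/X_win u_win /Y_win v_win].
  by have := ltn_ord u; have := ltn_ord v; lia.
Qed.

Lemma independent_le (A : {set Gamma n T'}) :
  independent A -> n * #|A| <= (n - b) * #|flags 'I_n T'|.
Proof.
move=> /forall_inP indA; pose A' := [set val f | f in A].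
rewrite -(card_imset _ val_inj) -/A'.
apply: (perm_flag_average (t := shift_perm) base_flagP).
  by apply/subsetP => _ /imsetP[f _ ->]; rewrite inE (valP f).
(* With [c = n - b], the distances to exclude are those from [n - b] to [n - c = b]. *)
move=> s; apply: katona_cycle; [lia|lia|] => i j.
rewrite !inE => /imsetP[f Af def_f] /imsetP[g Ag def_g] lt_ij.
apply/negP => dist_ij.
have gp := @base_flag_shift_general s i j lt_ij.
rewrite def_f def_g in gp; have {}gp := gp ltac:(lia).
have /forall_inP/(_ _ Ag)/negP := indA _ Af; apply.
(* Adjacency also asks for [f != g], which holds because a flag with a member of size [b] is not in
   general position with itself. *)
rewrite /= /flag_adj gp andbT; apply: contraTneq gp => ->.
apply: (@flag_not_general_self _ T' b); first by rewrite inE (valP g).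
by rewrite in_fsetU in_fset1 eqxx orbT.
Qed.

End CycleOfFlags.

(** * The two bounds on the independence number *)

Theorem mainTheorem1 (b n : nat) (T : {fset nat})
    (b_gt0 : 0 < b) (n_gt0 : 0 < n)
    (T_neq0 : T != fset0)
    (T_sub : forall t : nat, t \in T -> 1 <= t <= n)
    (maxT_le : \max_(t <- T) t + 3 * b <= 2 * n)
    (n_lt : 2 * n < 4 * b) :
  independence_number (Gamma n (T `|` [fset b])%fset) =
    'C(n - 1, b) * #|Gamma b T|.
Proof.
have T_le k : k \in T -> k + 3 * b <= 2 * n.
  move=> Tk; apply: leq_trans maxT_le; rewrite leq_add2r.
  exact: (leq_bigmax_seq (F := id)).
have T_gt0 k : k \in T -> 0 < k by case/T_sub/andP.
have T_lt k : k \in T -> k < b by move/T_le; lia.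
have n_lt2b : n < 2 * b by lia.
have b_lt : b < n by lia.
have b_proper : 0 < b < #|'I_n| by rewrite card_ord b_gt0.
set T' := (T `|` _)%fset.
have T'b : b \in T' by rewrite in_fsetU in_fset1 eqxx orbT.
rewrite card_Gamma_on; apply/eqP; rewrite eqn_leq; apply/andP; split.
  apply/bigmax_leqP => A indA; rewrite -(leq_pmul2l n_gt0).
  apply: leq_trans (independent_le n_gt0 n_lt2b b_lt T_gt0 T_le indA) _.
  (* By [n * 'C(n - 1, b) = (n - b) * 'C(n, b)], it remains to bound the number of all flags, which
     is done by counting them over all [b]-sets. *)
  rewrite mulnA subn1 mul_bin_down -mulnA leq_mul2l; apply/orP; right.
  rewrite -[X in 'C(X, b)]card_ord -cardsT -cards_draws.
  rewrite -card_flags_over //; last by move=> B /[!inE] /andP[_ /eqP].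
  apply/subset_leq_card/subsetP => f flag_f; rewrite inE flag_f /=.
  have /flagsP[_ _ _ /(_ b T'b)[B fB cardB]] := flag_f.
  by apply/exists_inP; exists B; rewrite // inE subsetT cardB eqxx.
(* For the lower bound, [p] is the point that the [b]-sets in [BB] miss. *)
pose p := Ordinal n_gt0.
pose BB := [set B : {set 'I_n} | B \subset ~: [set p] & #|B| == b].
pose A0 := [set f : Gamma n T' | [exists B in BB, B \in val f]].
apply: (@bigmax_sup _ A0); last first.
  have <- : #|BB| = 'C(n - 1, b) by rewrite cards_draws cardsC1 card_ord subn1.
  rewrite -card_flags_over //; last by move=> B /[!inE] /andP[_ /eqP].
  rewrite -[X in _ <= X](card_imset _ val_inj).
  apply/subset_leq_card/subsetP => f.
  rewrite inE => /andP[]; rewrite inE => flag_f BBf.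
  by apply/imsetP; exists (Sub f flag_f); rewrite // inE.
apply/forall_inP => f /[!inE] /exists_inP[B /[!inE] /andP[Bp /eqP cardB] fB].
apply/forall_inP => g /[!inE] /exists_inP[C /[!inE] /andP[Cp /eqP cardC] gC].
apply/nandP; right; apply/negP => /forall_inP/(_ B fB)/forall_inP/(_ C gC).
case/orP => /eqP.
  have pN (D : {set 'I_n}) : D \subset ~: [set p] -> (p \in D) = false.
    by move/subsetP=> sub; apply/negP => /sub; rewrite !inE eqxx.
  by move/setP/(_ p); rewrite in_setU in_setT !pN.
(* Disjoint [B] and [C] would fill [2 * b] points, more than [n]. *)
move=> BC0; have := cardsUI B C; rewrite BC0 cards0 addn0 cardB cardC => cardU.
have := subset_leq_card (subsetT (B :|: C)); rewrite cardU cardsT card_ord; lia.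
Qed.
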